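(* Let $P_0,P_1\in\mathbb{S}^n_{++}$. Then $$P_t^{\rm info}=P_0^{1/2}\left(P_0^{-1/2}P_1P_0^{-1/2}\right)^tP_0^{1/2},\qquad A^{\rm info}=\tfrac12P_0^{1/2}\log\left(P_0^{-1/2}P_1P_0^{-1/2}\right)P_0^{-1/2}$$ (with $A_t=A^{\rm info}$ constant in $t$) are the unique pair of minimizers of $$\min_{P_t,A_t}\left\{\int_0^1 f_{P_t}^{{\rm info},2}(A_t)\,dt\;\Big|\;\dot P_t=A_tP_t+P_tA_t',\ P_0,P_1\text{ specified}\right\},$$ where $f_P^{{\rm info},2}(A)=4\operatorname{tr}(P^{-1}APA')$.
   Context: $\mathbb{S}^n_{++}$ is the set of real symmetric positive definite $n\times n$ matrices; $'$ denotes transpose; $P^{1/2}$ is the unique positive definite square root; $\log$ and real powers of positive definite matrices are the usual (spectral) ones. The minimization is over pairs $(P_t,A_t)_{t\in[0,1]}$ with $P_t\in\mathbb{S}^n_{++}$ continuously differentiable in $t$, $A_t\in\mathbb{R}^{n\times n}$ continuous in $t$, satisfying the stated differential equation, where $P_t$ takes the prescribed values $P_0$ at $t=0$ and $P_1$ at $t=1$. *)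

(* Defs.v *)
(* MathComp / MathComp-Analysis, over an arbitrary [R : realType]. *)
From HB Require Import structures.
From mathcomp Require Import all_boot all_order all_algebra.
From mathcomp Require Import all_classical all_reals all_analysis.

Set Implicit Arguments.
Unset Strict Implicit.
Unset Printing Implicit Defensive.

Import Order.TTheory GRing.Theory Num.Theory.
Import numFieldNormedType.Exports.

Local Open Scope classical_set_scope.
Local Open Scope ring_scope.

Definition posdefmx (R : realType) (n : nat) (P : 'M[R]_n) : Prop :=
  P^T = P /\ forall x : 'cV[R]_n, x != 0 -> 0 < (x^T *m P *m x) 0 0.

Definition orthogonalmx (R : realType) (n : nat) (U : 'M[R]_n) : Prop :=
  U *m U^T = 1%:M.

(* The value is the junk matrix 0 when P has no positive definite square
   root, that is, when P is not itself positive definite. *)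
Definition sqrtmx (R : realType) (n : nat) (P : 'M[R]_n) : 'M[R]_n :=
  xget 0 [set Q : 'M[R]_n | posdefmx Q /\ Q *m Q = P].

(* Spectral calculus: if A = U diag(d) U^T with U orthogonal, then
   f(A) = U diag(f(d)) U^T, whichever decomposition is chosen (see mxfunE).
   The value is the junk matrix 0 when A is not orthogonally diagonalizable,
   that is, when A is not symmetric. *)
Definition mxfun (R : realType) (n : nat) (f : R -> R) (A : 'M[R]_n) :
    'M[R]_n :=
  xget 0 [set B : 'M[R]_n | exists (U : 'M[R]_n) (d : 'rV[R]_n),
    [/\ orthogonalmx U, A = U *m diag_mx d *m U^T
      & B = U *m diag_mx (map_mx f d) *m U^T]].

Lemma mxfunE (R : realType) (n : nat) (f : R -> R) (U : 'M[R]_n)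
    (d : 'rV[R]_n) : orthogonalmx U ->
  mxfun f (U *m diag_mx d *m U^T) = U *m diag_mx (map_mx f d) *m U^T.
Proof.
move=> oU; apply: xget_unique; first by exists U, d.
move=> B [V [e [oV UV ->]]].
have U'U : U^T *m U = 1%:M by apply: mulmx1C.
have V'V : V^T *m V = 1%:M by apply: mulmx1C.
pose W := V^T *m U.
have WE : W *m diag_mx d = diag_mx e *m W.
  have : V^T *m (U *m diag_mx d *m U^T) *m U
       = V^T *m (V *m diag_mx e *m V^T) *m U by rewrite UV.
  by rewrite !mulmxA V'V mul1mx -[_ *m U^T *m U]mulmxA U'U mulmx1 /W.
have fWE : W *m diag_mx (map_mx f d) = diag_mx (map_mx f e) *m W.
  apply/matrixP => i j; have /matrixP/(_ i j) := WE.
  rewrite !mul_mx_diag !mul_diag_mx 2![in X in X -> _]mxE 2!mxE.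
  rewrite [map_mx f d 0 j]mxE [map_mx f e 0 i]mxE.
  have [->|w0] := eqVneq (W i j) 0; first by rewrite !(mul0r, mulr0).
  by rewrite mulrC => /(mulIf w0) ->; rewrite mulrC.
have -> : V^T = W *m U^T by rewrite /W -mulmxA oU mulmx1.
by rewrite mulmxA -[V *m _ *m W]mulmxA -fWE /W !mulmxA oV mul1mx.
Qed.

Definition logmx (R : realType) (n : nat) (A : 'M[R]_n) : 'M[R]_n :=
  mxfun (@ln R) A.

Definition powmx (R : realType) (n : nat) (A : 'M[R]_n) (t : R) : 'M[R]_n :=
  mxfun (fun x => x `^ t) A.

(* The derivative at an endpoint of [0, 1] is one-sided. *)
Definition has_derivative01 (R : realType) (n : nat) (P dP : R -> 'M[R]_n) :
    Prop :=
  forall t : R, t \in `[0, 1] ->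
    (s - t)^-1 *: (P s - P t) @[s --> within `[0, 1] t^'] --> dP t.

(* Curves are total functions on R, only constrained on [0, 1]. *)
Definition feasible (R : realType) (n : nat) (P0 P1 : 'M[R]_n)
    (P A : R -> 'M[R]_n) : Prop :=
  [/\ forall t : R, t \in `[0, 1] -> posdefmx (P t),
      {within `[0, 1], continuous A},
      exists dP : R -> 'M[R]_n,
        [/\ has_derivative01 P dP,
            {within `[0, 1], continuous dP}
          & forall t : R, t \in `[0, 1] ->
              dP t = A t *m P t + P t *m (A t)^T]
    & P 0 = P0 /\ P 1 = P1].

Definition f_info (R : realType) (n : nat) (P A : 'M[R]_n) : R :=
  4 * \tr (invmx P *m A *m P *m A^T).

(* f_info is nonnegative for positive definite P, so that the Lebesgue
   integral is always meaningful in \bar R along feasible pairs. *)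
Definition info_action (R : realType) (n : nat) (P A : R -> 'M[R]_n) :
    \bar R :=
  (\int[lebesgue_measure]_(t in `[0%R, 1%R]) (f_info (P t) (A t))%:E)%E.

Definition is_minimizer (R : realType) (n : nat) (P0 P1 : 'M[R]_n)
    (P A : R -> 'M[R]_n) : Prop :=
  feasible P0 P1 P A /\
  forall Q B : R -> 'M[R]_n, feasible P0 P1 Q B ->
    (info_action P A <= info_action Q B)%E.

Definition P_info (R : realType) (n : nat) (P0 P1 : 'M[R]_n) (t : R) :
    'M[R]_n :=
  let S := sqrtmx P0 in
  S *m powmx (invmx S *m P1 *m invmx S) t *m S.

Definition A_info (R : realType) (n : nat) (P0 P1 : 'M[R]_n) : 'M[R]_n :=
  let S := sqrtmx P0 in
  2^-1 *: (S *m logmx (invmx S *m P1 *m invmx S) *m invmx S).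

(* Main.v *)
(* The minimal cost among all A with A P + P A^T = P' is the energy
   tr(P^-1 P' P^-1 P') of the affine-invariant metric, attained only when A P is
   symmetric. A congruence turns P_0 into the identity and P_1 into a diagonal
   matrix diag(e^c). Write P = L D L^T with L unit lower triangular and D
   diagonal with entries d_i. In the frame L D^(1/2) the tangent vector P' has
   diagonal entries d_i' / d_i, so the energy is at least
   sum_i (d_i' / d_i)^2 >= sum_i (2 c_i (ln d_i)' - c_i^2), whose integral
   depends only on the endpoints and equals sum_i c_i^2. Equality forces L = 1
   and d_i = e^(t c_i), which is the geodesic. No differentiation of a matrix
   logarithm is needed. The decomposition is built one Schur complement at a
   time, by induction on the size. *)
Require Import Defs.
From mathcomp Require Import all_boot all_order all_algebra.
From mathcomp Require Import all_classical all_reals all_analysis.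
From mathcomp Require Import ring lra complex.

Set Implicit Arguments.
Unset Strict Implicit.
Unset Printing Implicit Defensive.

Import Order.TTheory GRing.Theory Num.Theory.
Import numFieldNormedType.Exports.

Local Open Scope classical_set_scope.
Local Open Scope ring_scope.

(** * The real spectral theorem and positive definite matrices *)

(** Over [R[i]] the matrix is Hermitian, so its spectral values are real; the characteristic
    polynomial commutes with the embedding of [R], hence such a value is already an eigenvalue over
    [R]. *)
Lemma symmetric_eigenvalue (R : rcfType) (n : nat) (A : 'M[R]_n.+1) :
  A^T = A -> exists a, eigenvalue A a.
Proof.
move=> symA; pose f := real_complex R; pose C := map_mx f A.
have hC : C \is hermsymmx.
  apply/is_hermitianmxP; rewrite expr0 scale1r.
  apply/matrixP => i j; rewrite !mxE -[in LHS]symA mxE.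
  by apply/esym/CrealP; rewrite complex_real.
have /mxOverP/(_ 0 0)/complex_realP[a da] := hermitian_spectral_diag_real hC.
have /orthomx_spectralP Ceq := hermitian_normalmx hC.
exists a; rewrite eigenvalue_root_char -(fmorph_root f) map_char_poly.
rewrite -eigenvalue_root_char; apply/eigenvalueP.
(* Row 0 of the unitary spectral matrix is a left eigenvector for the first spectral value;
   unitarity prevents it from being zero. *)
exists (row 0 (spectralmx C)).
  rewrite -/C {2}Ceq !mulmxA -row_mul mulmxV ?spectral_unit// row1.
  by rewrite -rowE row_diag_mx da -scalemxAl -rowE.
apply: contra_neq (oner_neq0 (R [i])) => row0.
have /unitarymxP/matrixP/(_ 0 0) := spectral_unitarymx C.
rewrite [in X in _ = X -> _]mxE mulr1n => <-.
rewrite mxE big1// => i _; have /rowP/(_ i) := row0.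
by rewrite !mxE => ->; rewrite mul0r.
Qed.

Lemma orthogonalmxC (R : realType) n (U : 'M[R]_n) :
  orthogonalmx U -> U^T *m U = 1%:M.
Proof. exact: mulmx1C. Qed.

Lemma dot_mx_ge0 (R : realType) m n (x : 'M[R]_(m, n)) : 0 <= \tr (x^T *m x).
Proof.
apply: sumr_ge0 => i _; rewrite mxE; apply: sumr_ge0 => j _.
by rewrite mxE -expr2 sqr_ge0.
Qed.

Lemma dot_mx_eq0 (R : realType) m n (x : 'M[R]_(m, n)) :
  \tr (x^T *m x) = 0 -> x = 0.
Proof.
move=> /eqP x0; apply/matrixP => i j; move: x0.
rewrite psumr_eq0 => [/allP/(_ j)|k _]; last first.
  by rewrite mxE sumr_ge0// => l _; rewrite mxE -expr2 sqr_ge0.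
rewrite mem_index_enum mxE => /(_ isT) /=.
rewrite psumr_eq0 => [/allP/(_ i)|k _]; last by rewrite mxE -expr2 sqr_ge0.
by rewrite mem_index_enum !mxE -expr2 sqrf_eq0 => /(_ isT)/eqP.
Qed.

(* A Householder reflection exchanges two vectors of the same length. *)
Lemma householder (R : realType) n (u v : 'cV[R]_n) :
  u^T *m u = v^T *m v -> exists U : 'M[R]_n, orthogonalmx U /\ U *m u = v.
Proof.
move=> uv; have [->|u_v] := eqVneq u v.
  by exists 1%:M; rewrite /orthogonalmx trmx1 !mul1mx.
pose w : 'cV[R]_n := v - u; pose k : R := (w^T *m w) 0 0.
(* The reflection in the hyperplane orthogonal to [w = v - u]. Equality of the two lengths gives
   [w^T u = - k / 2], so that [H u = u + w = v]. *)
pose H : 'M[R]_n := 1%:M - (2 / k) *: (w *m w^T).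
have k0 : k != 0.
  apply: contra_neq u_v => k0; have : w = 0.
    by apply: dot_mx_eq0; rewrite trace_mx11.
  by move/eqP; rewrite subr_eq0 => /eqP.
have wuE : w^T *m u = (- (k / 2))%:M.
  rewrite [LHS]mx11_scalar; congr _%:M.
  have vu : (u^T *m v) 0 0 = (v^T *m u) 0 0.
    by rewrite -[v in LHS]trmxK -trmx_mul mxE.
  have := congr1 (fun M : 'M[R]_1 => M 0 0) uv.
  rewrite /k /w linearB/= !mulmxBl !mulmxBr => uv00.
  rewrite ![(_ - _ : 'M[R]_1) 0 0]mxE ![(- _ : 'M[R]_1) 0 0]mxE.
  rewrite ![(_ - _ : 'M[R]_1) 0 0]mxE ![(- _ : 'M[R]_1) 0 0]mxE vu uv00.
  by field.
have symH : H^T = H.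
  by rewrite /H linearB/= trmx1 linearZ/= trmx_mul trmxK.
exists H; split.
  rewrite /orthogonalmx symH /H mulmxBl !mulmxBr !mul1mx mulmx1.
  rewrite -!scalemxAl -!scalemxAr mulmxA -(mulmxA w) [w^T *m w]mx11_scalar -/k.
  rewrite mul_mx_scalar -scalemxAl !scalerA.
  have -> : 2 / k * (2 / k * k) = 2 / k + 2 / k :> R by field.
  by rewrite scalerDl opprB addrK subrK.
rewrite /H mulmxBl mul1mx -scalemxAl -mulmxA wuE mul_mx_scalar scalerA.
have -> : 2 / k * - (k / 2) = - 1 :> R by field.
by rewrite scaleN1r opprK /w addrC subrK.
Qed.

Lemma trmx_scale (R : pzRingType) m n (a : R) (A : 'M[R]_(m, n)) :
  (a *: A)^T = a *: A^T.
Proof. by apply/matrixP => i j; rewrite !mxE. Qed.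

(** Deflation: a Householder reflection sends the first basis vector to a unit eigenvector. After
    conjugation the first column is a multiple of that basis vector, symmetry clears the first row
    as well, and induction treats the remaining block. *)
Lemma real_symmetric_spectral (R : realType) n (A : 'M[R]_n) : A^T = A ->
  exists (U : 'M[R]_n) (d : 'rV[R]_n),
    orthogonalmx U /\ A = U *m diag_mx d *m U^T.
Proof.
elim: n A => [|n IHn] A symA.
  exists 1%:M, 0; rewrite /orthogonalmx trmx1 mulmx1; split => //.
  by apply/matrixP => -[].
have [a /eigenvalueP[x xA x0]] := symmetric_eigenvalue symA.
have xx0 : 0 < (x *m x^T) 0 0.
  rewrite -trace_mx11 -{1}[x]trmxK lt_neqAle dot_mx_ge0 andbT eq_sym.
  by apply: contra_neq x0 => /dot_mx_eq0 => xT0; rewrite -[x]trmxK xT0 trmx0.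
pose v := (Num.sqrt ((x *m x^T) 0 0))^-1 *: x^T.
have vv : v^T *m v = 1%:M.
  rewrite /v trmx_scale trmxK -scalemxAl -scalemxAr scalerA -expr2 exprVn.
  rewrite sqr_sqrtr ?ltW// [x *m x^T]mx11_scalar scale_scalar_mx mxE mulr1n.
  by rewrite mulVf// gt_eqF.
have Av : A *m v = a *: v.
  by rewrite -scalemxAr -[A]symA -trmx_mul xA trmx_scale scalerA mulrC -scalerA.
pose e : 'cV[R]_n.+1 := delta_mx 0 0.
have ee : e^T *m e = v^T *m v.
  rewrite vv trmx_delta mul_delta_mx.
  by apply/matrixP => i j; rewrite !ord1 !mxE.
have [H [oH He]] := householder ee.
have H'H := orthogonalmxC oH.
pose B : 'M[R]_(1 + n) := H^T *m A *m H.
have symB : B^T = B by rewrite /B !trmx_mul trmxK symA mulmxA.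
have Be : B *m e = a *: e.
  by rewrite /B -!mulmxA He Av -scalemxAr -He mulmxA H'H mul1mx.
have AE : A = H *m B *m H^T.
  by rewrite /B !mulmxA oH mul1mx -mulmxA oH mulmx1.
clearbody B; have B0 i : B i 0 = a * (i == 0)%:R.
  by have /matrixP/(_ i 0) := Be; rewrite -colE !mxE andbT.
have lshift0 : lshift n (0 : 'I_1) = 0 :> 'I_n.+1 by apply: val_inj.
have ulB : ulsubmx B = a%:M.
  by apply/matrixP => i j; rewrite !ord1 !mxE lshift0 B0 eqxx mulr1.
have dlB : dlsubmx B = 0.
  by apply/matrixP => i j; rewrite !ord1 !mxE lshift0 B0 mulr0.
have urB : ursubmx B = 0 by rewrite -symB -trmx_dlsub dlB trmx0.
have [|U [d [oU dE]]] := IHn (drsubmx B); first by rewrite trmx_drsub symB.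
pose V : 'M[R]_(1 + n) := block_mx 1%:M 0 0 U.
have oV : V *m V^T = 1%:M.
  rewrite tr_block_mx !trmx0 trmx1 mulmx_block !(mulmx0, mul0mx, mulmx1).
  by rewrite oU !(addr0, add0r) -scalar_mx_block.
exists (H *m V), (row_mx a%:M d); split.
  by rewrite /orthogonalmx trmx_mul mulmxA -(mulmxA H) oV mulmx1.
have BE : B = V *m diag_mx (row_mx a%:M d : 'rV[R]_(1 + n)) *m V^T.
  rewrite -[B]submxK ulB dlB urB dE diag_mx_row.
  rewrite tr_block_mx !trmx0 trmx1 !mulmx_block.
  rewrite !(mulmx0, mul0mx, mulmx1, mul1mx, addr0, add0r).
  by congr block_mx; apply/matrixP => i j; rewrite !ord1 !mxE eqxx.
by rewrite AE BE trmx_mul !mulmxA.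
Qed.

(** * Positive definite matrices, trace forms and the affine-invariant energy *)

Section PositiveDefinite.
Variable R : realType.

Lemma posdefmx_unit n (P : 'M[R]_n) : posdefmx P -> P \in unitmx.
Proof.
move=> [symP posP]; rewrite -row_free_unit -kermx_eq0; apply/rowV0P => v.
move=> /sub_kermxP vP; apply/eqP/negP => /negP v0.
have /posP : v^T != 0 by rewrite -trmx0 (inj_eq trmx_inj).
by rewrite trmxK vP mul0mx mxE ltxx.
Qed.

Lemma posdefmx_congr n (T P : 'M[R]_n) :
  T \in unitmx -> posdefmx P -> posdefmx (T *m P *m T^T).
Proof.
move=> uT [symP posP]; split; first by rewrite !trmx_mul trmxK symP mulmxA.
move=> x x0; have /posP : T^T *m x != 0.
  have uT' : T^T \in unitmx by rewrite unitmx_tr.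
  by apply: contra_neq x0 => Tx; rewrite -[x](mulKmx uT') Tx mulmx0.
by rewrite trmx_mul trmxK !mulmxA.
Qed.

Lemma posdefmx_inv n (P : 'M[R]_n) : posdefmx P -> posdefmx (invmx P).
Proof.
move=> pP; have uP := posdefmx_unit pP; have symP := pP.1.
have := posdefmx_congr (_ : invmx P \in unitmx) pP.
by rewrite mulVmx// mul1mx trmx_inv symP unitmx_inv; apply.
Qed.

Lemma posdefmx_diag n (d : 'rV[R]_n) :
  posdefmx (diag_mx d) <-> forall i, 0 < d 0 i.
Proof.
have qE (x : 'cV[R]_n) :
    (x^T *m diag_mx d *m x) 0 0 = \sum_i d 0 i * x i 0 ^+ 2.
  by rewrite mul_mx_diag mxE; apply: eq_bigr => i _; rewrite !mxE mulrAC mulrC.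
split=> [[_ posd] i|d0].
  have /posd : (delta_mx i 0 : 'cV[R]_n) != 0.
    by apply/eqP => /matrixP/(_ i 0)/eqP; rewrite !mxE !eqxx oner_eq0.
  rewrite qE (bigD1 i)//= big1 => [|j /negbTE ji]; rewrite !mxE ?eqxx ?ji.
    by rewrite expr1n mulr1 addr0.
  by rewrite expr0n mulr0.
split; first by rewrite tr_diag_mx.
move=> x x0; rewrite qE; have /cV0Pn[i xi0] := x0.
rewrite (bigD1 i)//= ltr_pwDl//; first by rewrite mulr_gt0 ?exprn_even_gt0.
by apply: sumr_ge0 => j _; rewrite mulr_ge0 ?sqr_ge0 ?ltW.
Qed.

Lemma posdefmx1 n : posdefmx (1%:M : 'M[R]_n).
Proof. by rewrite -diag_const_mx; apply/posdefmx_diag => i; rewrite mxE. Qed.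

Lemma posdefmx_sqrt n (P : 'M[R]_n) :
  posdefmx P -> exists2 Q : 'M[R]_n, posdefmx Q & Q *m Q = P.
Proof.
move=> pP; have [U [d [oU PE]]] := real_symmetric_spectral pP.1.
have U'U := orthogonalmxC oU; have [uU uU'] := mulmx1_unit oU.
have /posdefmx_diag d0 : posdefmx (diag_mx d).
  have := posdefmx_congr uU' pP.
  by rewrite PE trmxK !mulmxA U'U mul1mx -mulmxA U'U mulmx1.
exists (U *m diag_mx (map_mx Num.sqrt d) *m U^T).
  apply: posdefmx_congr => //.
  by apply/posdefmx_diag => i; rewrite mxE sqrtr_gt0.
rewrite !mulmxA -[_ *m U^T *m U]mulmxA U'U mulmx1 -(mulmxA U) mulmx_diag PE.
congr (_ *m diag_mx _ *m _); apply/rowP => i.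
by rewrite !mxE -expr2 sqr_sqrtr// ltW.
Qed.

(** The choice operator returns a member of any inhabited set, so the existence of a square root
    rules out the default value 0. *)
Lemma sqrtmxP n (P : 'M[R]_n) :
  posdefmx P -> posdefmx (sqrtmx P) /\ sqrtmx P *m sqrtmx P = P.
Proof.
move=> /posdefmx_sqrt[Q pQ QQ]; rewrite /sqrtmx.
by apply: (@xgetPex _ 0 [set Q : 'M[R]_n | posdefmx Q /\ Q *m Q = P]); exists Q.
Qed.

(** With [g] and [h] the square roots of [G] and [H], cyclicity of the trace turns the form into a
    squared Frobenius norm. Both the nonnegativity of the form and its definiteness follow. *)
Lemma mxtrace_posdef_sqr m n (G : 'M[R]_m) (H : 'M[R]_n) (X : 'M[R]_(m, n)) :
  posdefmx G -> posdefmx H -> exists g h,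
  [/\ g \in unitmx, h \in unitmx &
    \tr (G *m X *m H *m X^T) = \tr ((h *m X^T *m g)^T *m (h *m X^T *m g))].
Proof.
move=> /posdefmx_sqrt[g pg <-] /posdefmx_sqrt[h ph <-]; exists g, h.
split; rewrite ?posdefmx_unit// !trmx_mul trmxK pg.1 ph.1.
have -> : g *m g *m X *m (h *m h) *m X^T = g *m (g *m X *m h *m h *m X^T).
  by rewrite !mulmxA.
by rewrite mxtrace_mulC !mulmxA.
Qed.

Lemma mxtrace_posdef_ge0 m n (G : 'M[R]_m) (H : 'M[R]_n) (X : 'M[R]_(m, n)) :
  posdefmx G -> posdefmx H -> 0 <= \tr (G *m X *m H *m X^T).
Proof.
move=> pG pH; have [g [h [_ _ ->]]] := mxtrace_posdef_sqr X pG pH.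
exact: dot_mx_ge0.
Qed.

Lemma mxtrace_posdef_eq0 m n (G : 'M[R]_m) (H : 'M[R]_n) (X : 'M[R]_(m, n)) :
  posdefmx G -> posdefmx H -> \tr (G *m X *m H *m X^T) = 0 -> X = 0.
Proof.
move=> pG pH; have [g [h [ug uh ->]]] := mxtrace_posdef_sqr X pG pH.
move=> /dot_mx_eq0 hXg; apply: trmx_inj; rewrite trmx0.
by rewrite -[X^T](mulKmx uh) -[h *m _](mulmxK ug) hXg mul0mx mulmx0.
Qed.

(* The squared norm of the tangent vector D at P, for the affine-invariant
   metric on positive definite matrices. *)
Definition energy n (P D : 'M[R]_n) : R :=
  \tr (invmx P *m D *m invmx P *m D).

(** The factors [T] cancel cyclically under the trace. This invariance is what permits normalizing
    the endpoints and passing to the triangular frame. *)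
Lemma energy_congr n (T P D : 'M[R]_n) : T \in unitmx -> P \in unitmx ->
  energy (T *m P *m T^T) (T *m D *m T^T) = energy P D.
Proof.
move=> uT uP; have uT' : T^T \in unitmx by rewrite unitmx_tr.
rewrite /energy.
have -> : invmx (T *m P *m T^T) = invmx T^T *m invmx P *m invmx T.
  apply: (can_inj (mulmxK (_ : T *m P *m T^T \in unitmx))).
    by rewrite !unitmx_mul uT uP.
  rewrite mulVmx ?unitmx_mul ?uT ?uP// !mulmxA mulmxKV// -!(mulmxA _ _ P).
  by rewrite mulmxA mulmxKV// mulVmx.
rewrite !mulmxA !mulmxKV// mulmxK// mxtrace_mulC !mulmxA mulmxV//.
by rewrite mul1mx.
Qed.

(** Polarization: with [B = P^-1 A P] the right-hand side is the trace of
    [(B + A^T)^2 - (B - A^T)^2], that is [4 tr (B A^T)]. The first term depends only on the curve;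
    the second is nonnegative and vanishes exactly when [A P] is symmetric. *)
Lemma f_infoE n (P A : 'M[R]_n) : posdefmx P ->
  f_info P A = energy P (A *m P + P *m A^T) +
    \tr (invmx P *m (A *m P - P *m A^T) *m invmx P *m (A *m P - P *m A^T)^T).
Proof.
move=> pP; have uP := posdefmx_unit pP; have symP := pP.1.
rewrite /f_info /energy.
have -> : (A *m P - P *m A^T)^T = P *m A^T - A *m P.
  by rewrite linearB/= !trmx_mul trmxK symP.
pose B := invmx P *m A *m P.
have E1 : invmx P *m (A *m P + P *m A^T) = B + A^T.
  by rewrite mulmxDr mulmxA mulKmx.
have E2 : invmx P *m (A *m P - P *m A^T) = B - A^T.
  by rewrite mulmxBr mulmxA mulKmx.
have E3 : invmx P *m (P *m A^T - A *m P) = A^T - B.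
  by rewrite mulmxBr mulKmx// mulmxA.
rewrite E1 E2 -!mulmxA E1 E3.
rewrite !mulmxDl !mulmxDr !mulNmx !mulmxN !mxtraceD !raddfN/=.
have tBB : \tr (B *m B) = \tr (A *m A).
  by rewrite /B !mulmxA mulmxK// -mulmxA mxtrace_mulC !mulmxA mulmxK.
have tAA : \tr (A^T *m A^T) = \tr (A *m A).
  by rewrite -trmx_mul mxtrace_tr.
have tBA : \tr (A^T *m B) = \tr (B *m A^T) by rewrite mxtrace_mulC.
have -> : invmx P *m (A *m (P *m A^T)) = B *m A^T by rewrite !mulmxA.
by rewrite tBB tAA tBA; ring.
Qed.

End PositiveDefinite.

(** * Schur complement coordinates and the splitting of the energy *)

Section Schur.
Variables (R : realType) (n : nat).

Lemma posdefmx_drsubmx m (P : 'M[R]_(m + n)) :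
  posdefmx P -> posdefmx (drsubmx P).
Proof.
move=> [symP posP]; split; first by rewrite trmx_drsub symP.
move=> x x0; have /posP : col_mx (0 : 'cV_m) x != 0.
  by apply: contra_neq x0 => x0; rewrite -(col_mxKd (0 : 'cV_m) x) x0 linear0.
rewrite -{1}[P]submxK tr_col_mx mul_row_block mul_row_col.
by rewrite !(trmx0, mul0mx, mulmx0, add0r).
Qed.

Lemma posdefmx_diag_gt0 m (P : 'M[R]_m) i : posdefmx P -> 0 < P i i.
Proof.
move=> [_ posP]; have /posP : (delta_mx i 0 : 'cV[R]_m) != 0.
  by apply/eqP => /matrixP/(_ i 0)/eqP; rewrite !mxE !eqxx oner_eq0.
by rewrite trmx_delta -rowE -colE !mxE.
Qed.

(* Coordinates (p, u, S) on the positive definite matrices of size 1 + n, such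
   that P = L diag(p, S) L^T with L unit lower triangular of first column
   (1, u); dschur* are their differentials. *)
Implicit Types P D : 'M[R]_(1 + n).

Definition schur_u P : 'cV[R]_n := (P 0 0)^-1 *: dlsubmx P.

Definition schur_S P : 'M[R]_n :=
  drsubmx P - P 0 0 *: (schur_u P *m (schur_u P)^T).

Definition dschur_u P D : 'cV[R]_n :=
  (P 0 0)^-1 *: (dlsubmx D - D 0 0 *: schur_u P).

Definition dschur_S P D : 'M[R]_n :=
  let u := schur_u P in let x := dschur_u P D in
  drsubmx D - D 0 0 *: (u *m u^T) - P 0 0 *: (x *m u^T + u *m x^T).

Definition schur_L (u : 'cV[R]_n) : 'M[R]_(1 + n) := block_mx 1%:M 0 u 1%:M.

Lemma schur_LV u : schur_L u *m schur_L (- u) = 1%:M.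
Proof.
rewrite mulmx_block !(mulmx0, mul0mx, mulmx1, mul1mx, addr0, add0r) subrr.
by rewrite -scalar_mx_block.
Qed.

Lemma schur_L_unit u : schur_L u \in unitmx.
Proof. by case: (mulmx1_unit (schur_LV u)). Qed.

Lemma ulsubmx11 P : ulsubmx P = (P 0 0)%:M.
Proof.
rewrite [LHS]mx11_scalar !mxE; congr (P _ _)%:M; exact: val_inj.
Qed.

(** One block product serves both the point [P], with [b = 0], and its tangent vectors. *)
Lemma schur_conj (u : 'cV[R]_n) a (b : 'cV[R]_n) C :
  schur_L u *m block_mx a%:M b^T b C *m (schur_L u)^T =
  block_mx a%:M (a *: u + b)^T (a *: u + b)
    (C + a *: (u *m u^T) + (b *m u^T + u *m b^T)).
Proof.
rewrite tr_block_mx !(trmx0, trmx1) !mulmx_block.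
rewrite !(mulmx0, mul0mx, mulmx1, mul1mx, addr0, add0r).
rewrite !mul_mx_scalar !mul_scalar_mx linearD/= trmx_scale.
congr block_mx; rewrite mulmxDl -scalemxAl.
by rewrite [RHS]addrC [C + _]addrC !addrA [_ + a *: _]addrC !addrA.
Qed.

Lemma symmetric_block D : D^T = D ->
  D = block_mx (D 0 0)%:M (dlsubmx D)^T (dlsubmx D) (drsubmx D).
Proof. by move=> symD; rewrite trmx_dlsub symD -ulsubmx11 submxK. Qed.

Lemma schur_decomp P : posdefmx P ->
  P = schur_L (schur_u P) *m block_mx (P 0 0)%:M 0 0 (schur_S P)
      *m (schur_L (schur_u P))^T.
Proof.
move=> pP; have p0 : P 0 0 != 0 by rewrite gt_eqF// posdefmx_diag_gt0.
have := schur_conj (schur_u P) (P 0 0) 0 (schur_S P); rewrite trmx0 => ->.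
rewrite {1}[P]symmetric_block ?pP.1//.
congr block_mx; rewrite ?linearD/= ?trmx0 ?mulmx0 ?mul0mx ?addr0.
- by rewrite /schur_u scalerA divff// scale1r.
- by rewrite /schur_u scalerA divff// scale1r.
- by rewrite /schur_S subrK.
Qed.

(** This is the differential of P = L diag(p, S) L^T pulled back by L. Since the only nonzero block
    of L^-1 L' is u', the off-diagonal block is p u' and the diagonal blocks are p' and S'. *)
Lemma dschur_decomp P D : posdefmx P -> D^T = D ->
  let x : 'cV[R]_n := P 0 0 *: dschur_u P D in
  D = schur_L (schur_u P) *m block_mx (D 0 0)%:M x^T x (dschur_S P D)
      *m (schur_L (schur_u P))^T.
Proof.
move=> pP symD x; have p0 : P 0 0 != 0 by rewrite gt_eqF// posdefmx_diag_gt0.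
have xE : x = dlsubmx D - D 0 0 *: schur_u P.
  by rewrite /x /dschur_u scalerA divff// scale1r.
rewrite schur_conj {1}[D]symmetric_block//.
congr block_mx; rewrite ?{1}xE ?[_ *: _ + _]addrC ?subrK//.
have sE (a : R) (y u : 'cV[R]_n) :
    (a *: y) *m u^T + u *m (a *: y)^T = a *: (y *m u^T + u *m y^T).
  by rewrite trmx_scale -scalemxAl -scalemxAr -scalerDr.
by rewrite -xE sE addrAC /dschur_S !subrK.
Qed.

(** The inverse of L is [schur_L (- u)]; the congruence by it makes [P] block diagonal, with the
    Schur complement as its lower block. *)
Lemma schur_S_posdef P : posdefmx P -> posdefmx (schur_S P).
Proof.
move=> pP; pose V := schur_L (- schur_u P).
have uV : V \in unitmx by exact: schur_L_unit.
have VL : V *m schur_L (schur_u P) = 1%:M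
  by rewrite -[X in _ *m schur_L X]opprK schur_LV.
have := posdefmx_congr uV pP; rewrite {1}(schur_decomp pP) !mulmxA VL mul1mx.
rewrite -mulmxA -trmx_mul VL trmx1 mulmx1 => /posdefmx_drsubmx.
by rewrite block_mxKdr.
Qed.

(** In the frame L the base point is diag(p, S), so the squared blocks decouple; the two
    off-diagonal blocks contribute equally, which gives the factor 2. The factor [1%:M] puts the
    middle term in the shape of [mxtrace_posdef_ge0] and [mxtrace_posdef_eq0]. *)
Lemma energy_schur P D : posdefmx P -> D^T = D ->
  energy P D = (D 0 0 / P 0 0) ^+ 2
    + 2 * P 0 0 * \tr (invmx (schur_S P) *m dschur_u P D *m 1%:M
                      *m (dschur_u P D)^T)
    + energy (schur_S P) (dschur_S P D).
Proof.
move=> pP symD; have p0 := lt0r_neq0 (posdefmx_diag_gt0 0 pP).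
have pS := schur_S_posdef pP; have uS := posdefmx_unit pS.
have ub : block_mx ((P 0 0)%:M : 'M[R]_1) 0 0 (schur_S P) \in unitmx.
  have := posdefmx_unit pP; rewrite {1}(schur_decomp pP) !unitmx_mul.
  by case/andP => /andP[_ ->].
rewrite {1}(schur_decomp pP) {1}(dschur_decomp pP symD).
rewrite energy_congr ?schur_L_unit// /energy invmx_block_diag//.
rewrite invmx_scalar !mulmx_block !(mulmx0, mul0mx, addr0, add0r).
rewrite mxtrace_block !mul_scalar_mx trmx_scale.

rewrite !mxtraceD -!addrA; congr (_ + _).
  by rewrite trace_mx11 !mul_mx_scalar !mxE eqxx mulr1n; ring.
rewrite addrA; congr (_ + _).
move: (dschur_u P D : 'cV[R]_n) (invmx (schur_S P) : 'M[R]_n) => x q.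
rewrite mulmx1 scalerA mulVf// scale1r mul_mx_scalar -!scalemxAr -!scalemxAl.
rewrite !mxtraceZ -[x^T *m q *m x]mulmxA.
by rewrite [\tr (x^T *m _)]mxtrace_mulC mulVKf// -mulrA mulr2n mulrDl mul1r.
Qed.

End Schur.

(** * Continuously differentiable functions on [0, 1] *)

Section UnitInterval.
Variable R : realType.
Implicit Types (f g df dg : R -> R) (t : R).

Definition cont01 f : Prop := {within `[0, 1], continuous f}.

Lemma cont01_cst (a : R) : cont01 (fun=> a).
Proof. by move=> x; exact: cvg_cst. Qed.

Lemma cont01_id : cont01 id.
Proof. by apply: continuous_subspaceT => x; exact: cvg_id. Qed.

Lemma cont01D f g : cont01 f -> cont01 g -> cont01 (fun t => f t + g t).
Proof. by move=> cf cg x; exact: cvgD (cf x) (cg x). Qed.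

Lemma cont01M f g : cont01 f -> cont01 g -> cont01 (fun t => f t * g t).
Proof. by move=> cf cg x; exact: cvgM (cf x) (cg x). Qed.

Lemma cont01N f : cont01 f -> cont01 (fun t => - f t).
Proof. by move=> cf x; exact: cvgN (cf x). Qed.

Lemma cont01B f g : cont01 f -> cont01 g -> cont01 (fun t => f t - g t).
Proof. by move=> cf cg; apply: cont01D => //; exact: cont01N. Qed.

Lemma cont01_sum (I : Type) (r : seq I) (P : pred I) (F : I -> R -> R) :
  (forall i, cont01 (F i)) -> cont01 (fun t => \sum_(i <- r | P i) F i t).
Proof.
move=> cF; elim: r => [|i r IHr].
  by under eq_fun do rewrite big_nil; exact: cont01_cst.
under eq_fun do rewrite big_cons; case: (P i) => //.
exact: cont01D.
Qed.

Lemma cont01_prod (I : Type) (r : seq I) (P : pred I) (F : I -> R -> R) :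
  (forall i, cont01 (F i)) -> cont01 (fun t => \prod_(i <- r | P i) F i t).
Proof.
move=> cF; elim: r => [|i r IHr].
  by under eq_fun do rewrite big_nil; exact: cont01_cst.
under eq_fun do rewrite big_cons; case: (P i) => //.
exact: cont01M.
Qed.

Lemma cont01_comp f (g : R -> R) : cont01 f ->
  (forall t : R, t \in `[0, 1] -> {for f t, continuous g}) ->
  cont01 (fun t => g (f t)).
Proof.
move=> /subspace_continuousP cf cg; apply/subspace_continuousP => t t01.
exact: cvg_comp (cf t t01) (cg t t01).
Qed.

Lemma cont01V f : cont01 f -> (forall t : R, t \in `[0, 1] -> f t != 0) ->
  cont01 (fun t => (f t)^-1).
Proof.
by move=> cf f0; apply: cont01_comp cf _ => t /f0; exact: inv_continuous.
Qed.

Lemma cont01_eq f g :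
  (forall t : R, t \in `[0, 1] -> f t = g t) -> cont01 f -> cont01 g.
Proof.
move=> fg cf; apply: subspace_eq_continuous cf => t.
by rewrite inE => /fg.
Qed.

(** The endpoint values are one-sided limits of a function that is constant nearby. *)
Lemma cont01_oo f (a : R) :
  cont01 f -> (forall t : R, t \in `]0, 1[ -> f t = a) ->
  forall t : R, t \in `[0, 1] -> f t = a.
Proof.
have /continuous_within_itvP P := @ltr01 R.
move=> /P[_ f0 f1] fa t.
rewrite in_itv/= => /andP[]; rewrite le_eqVlt => /predU1P[<- _|t0].
  apply: (cvg_unique _ f0) => //; apply: cvg_near_cst.
  near=> x; apply: fa; rewrite in_itv/=; apply/andP; split; near: x.
    exact: nbhs_right_gt.
  exact: nbhs_right_lt.
rewrite le_eqVlt => /predU1P[->|t1]; last by apply: fa; rewrite in_itv/= t0.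
apply: (cvg_unique _ f1) => //; apply: cvg_near_cst.
near=> x; apply: fa; rewrite in_itv/=; apply/andP; split; near: x.
  exact: nbhs_left_gt.
exact: nbhs_left_lt.
Unshelve. all: by end_near. Qed.

(** Differentiability is asked at interior points only, where it is two-sided and the usual calculus
    rules apply; with continuity up to the endpoints this suffices for the mean value theorem and
    for integration of the derivative. *)
Definition C1on01 f df : Prop :=
  [/\ cont01 f, cont01 df &
    forall t : R, t \in `]0, 1[ -> is_derive t 1 f (df t)].

Lemma C1on01_cst (a : R) : C1on01 (fun=> a) (fun=> 0).
Proof.
by split; [exact: cont01_cst..|move=> t _; exact: is_derive_cst].
Qed.

Lemma C1on01_id : C1on01 id (fun=> 1).
Proof.
by split; [exact: cont01_id|exact: cont01_cst|move=> t _; exact: is_derive_id].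
Qed.

Lemma C1on01D f df g dg : C1on01 f df -> C1on01 g dg ->
  C1on01 (fun t => f t + g t) (fun t => df t + dg t).
Proof.
move=> [cf cdf ff] [cg cdg gg]; split; [exact: cont01D|exact: cont01D|].
by move=> t t01; exact: is_deriveD (ff t t01) (gg t t01).
Qed.

Lemma C1on01M f df g dg : C1on01 f df -> C1on01 g dg ->
  C1on01 (fun t => f t * g t) (fun t => f t * dg t + g t * df t).
Proof.
move=> [cf cdf ff] [cg cdg gg]; split; first exact: cont01M.
  by apply: cont01D; exact: cont01M.
by move=> t t01; exact: is_deriveM (ff t t01) (gg t t01).
Qed.

Lemma C1on01N f df : C1on01 f df -> C1on01 (fun t => - f t) (fun t => - df t).
Proof.
move=> [cf cdf ff]; split; [exact: cont01N|exact: cont01N|].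
by move=> t t01; exact: is_deriveN (ff t t01).
Qed.

Lemma C1on01B f df g dg : C1on01 f df -> C1on01 g dg ->
  C1on01 (fun t => f t - g t) (fun t => df t - dg t).
Proof. by move=> Cf Cg; apply: C1on01D => //; exact: C1on01N. Qed.

Lemma C1on01Z (a : R) f df :
  C1on01 f df -> C1on01 (fun t => a * f t) (fun t => a * df t).
Proof.
move=> [cf cdf ff]; split.
- exact/cont01M/cf/cont01_cst.
- exact/cont01M/cdf/cont01_cst.
- by move=> t t01; exact: is_deriveZ (ff t t01).
Qed.

Lemma C1on01_sum n (F dF : 'I_n -> R -> R) : (forall i, C1on01 (F i) (dF i)) ->
  C1on01 (fun t => \sum_(i < n) F i t) (fun t => \sum_(i < n) dF i t).
Proof.
move=> CF; split; [by apply: cont01_sum => i; case: (CF i)..|].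
move=> t t01.
have Ft i : is_derive t 1 (F i) (dF i t) by case: (CF i) => _ _; apply.
rewrite (_ : (fun s => _) = \sum_(i < n) F i); first exact: is_derive_sum.
by apply/funext => s; rewrite fct_sumE.
Qed.

Lemma C1on01V f df : (forall t : R, t \in `[0, 1] -> f t != 0) -> C1on01 f df ->
  C1on01 (fun t => (f t)^-1) (fun t => - (f t ^- 2 * df t)).
Proof.
move=> f0 [cf cdf ff]; have cV := cont01V cf f0; split => //.
  apply/cont01N/cont01M => //; apply: cont01V => [|t t01].
    by apply: cont01M.
  by rewrite expf_neq0 ?f0.
move=> t t01; have ft0 := f0 t (subset_itv_oo_cc t01).
by rewrite -mulNr; exact: is_deriveV (ff t t01).
Qed.

Lemma C1on01_ln f df :
  (forall t : R, t \in `[0, 1] -> 0 < f t) -> C1on01 f df ->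
  C1on01 (fun t => ln (f t)) (fun t => df t / f t).
Proof.
move=> f0 [cf cdf ff]; split.
- by apply: cont01_comp cf _ => t /f0; exact: continuous_ln.
- by apply: cont01M => //; apply: cont01V => // t /f0/lt0r_neq0.
- move=> t t01; have ft0 := f0 t (subset_itv_oo_cc t01).
  by rewrite mulrC; exact: is_derive1_comp (is_derive1_ln ft0) (ff t t01).
Qed.

Lemma C1on01_eq0 f df :
  C1on01 f df -> (forall t : R, t \in `]0, 1[ -> df t = 0) ->
  forall t : R, t \in `[0, 1] -> f t = f 0.
Proof.
move=> [cf _ ff] df0 t; rewrite in_itv/= => /andP[]; rewrite le_eqVlt.
move=> /predU1P[<-//|t0] t1.
have sub : {subset `]0, t[ <= `]0, 1[}.
  by move=> x; rewrite !in_itv/= => /andP[-> xt]; rewrite (lt_le_trans xt).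
have dt x : x \in `]0, t[ -> is_derive x 1 f (df x) by move=> /sub/ff.
have ct : {within `[0, t], continuous f}.
  apply: continuous_subspaceW cf => x /=; rewrite !in_itv/= => /andP[-> xt].
  exact: le_trans xt t1.
have [c cI] := MVT t0 dt ct.
by rewrite df0 ?mul0r ?sub// => /subr0_eq.
Qed.

End UnitInterval.

(** * Integral bounds from a calibration, with the case of equality *)

Section CalibrationIntegral.
Variable R : realType.
Local Notation mu := (@lebesgue_measure R).

Lemma cont01_integrable (f : R -> R) :
  cont01 f -> mu.-integrable `[0, 1] (EFin \o f).
Proof. by apply: continuous_compact_integrable; exact: segment_compact. Qed.

Implicit Type t : R.
Lemma integral01_gt0 (g : R -> R) (t0 : R) : cont01 g ->
  (forall t : R, t \in `[0, 1] -> 0 <= g t) -> t0 \in `]0, 1[ -> 0 < g t0 ->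
  (0 < \int[mu]_(t in `[0%R, 1%R]) (g t)%:E)%E.
Proof.
move=> cg g0 t0I gt0.
have /continuous_within_itvP P := @ltr01 R.
have /P[gc _ _] := cg.
have nb : \forall t \near t0, g t0 / 2 < g t /\ t \in `]0, 1[.
  near=> t; split; last by near: t; exact: near_in_itvoo.
  near: t; apply: (cvgr_gt _ (gc _ t0I)).
  by rewrite ltr_pdivrMr// ltr_pMr// ltr1n.
have [e /= e0 he] := nb.
(* Half the radius keeps the closed interval [J] inside the open ball of radius [e]; [J] has length
   [e], so the integral is at least [e * (g t0 / 2)]. *)
pose J := `[t0 - e / 2, t0 + e / 2]%classic : set R.
have Jsub t : J t -> g t0 / 2 < g t /\ t \in `]0, 1[.
  rewrite /J/= in_itv/= => /andP[a b]; apply: he.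
  rewrite /ball_ /= ltr_distlC; apply/andP; split.
    by apply: lt_le_trans a; rewrite ltrD2l ltrN2 ltr_pdivrMr// ltr_pMr// ltr1n.
  by apply: le_lt_trans b _; rewrite ltrD2l ltr_pdivrMr// ltr_pMr// ltr1n.
have mJ : measurable J by exact: measurable_itv.
have ig := cont01_integrable cg.
have le1 : (\int[mu]_(t in J) (g t)%:E <=
    \int[mu]_(t in `[0%R, 1%R]) (g t)%:E)%E.
  apply: ge0_subset_integral => //.
  - exact: measurable_int ig.
  - by move=> x /Jsub[_ /subset_itv_oo_cc].
apply: lt_le_trans le1.
have le2 : (\int[mu]_(t in J) (cst (g t0 / 2)%:E t) <=
    \int[mu]_(t in J) (g t)%:E)%E.
  apply: ge0_le_integral => //.
  - by move=> x _; rewrite lee_fin divr_ge0// ltW.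
  - apply: measurable_funS (measurable_int _ ig) => //.
    by move=> x /Jsub[_ /subset_itv_oo_cc].
  - by move=> x /Jsub[h _]; rewrite lee_fin ltW.
apply: lt_le_trans le2.
rewrite integral_cst// /J /= lebesgue_measure_itv/= lte_fin ltrD2l.
have e2 : 0 < e / 2 by rewrite divr_gt0.
rewrite gtrN// -EFinB -EFinM lte_fin mulr_gt0 ?divr_gt0//.
by rewrite opprD opprK addrACA subrr add0r addr_gt0.
Unshelve. all: by end_near. Qed.

(** The lower bound is the derivative of [b t - K * t], so its integral is read off at the
    endpoints. In the case of equality the difference [g] is continuous and nonnegative with
    integral at most 0, hence it vanishes. *)
Lemma integral01_calibration (f b db : R -> R) (K : R) :
  cont01 f -> C1on01 b db -> (forall t : R, t \in `[0, 1] -> db t - K <= f t) ->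
  ((b 1 - b 0 - K)%:E <= \int[mu]_(t in `[0%R, 1%R]) (f t)%:E)%E /\
  ((\int[mu]_(t in `[0%R, 1%R]) (f t)%:E <= (b 1 - b 0 - K)%:E)%E ->
   forall t : R, t \in `]0, 1[ -> f t = db t - K).
Proof.
move=> cf Cb hf.
pose g t := f t - (db t - K).
have [cB ch B'] : C1on01 (fun t => b t - K * t) (fun t => db t - K * 1).
  by apply: C1on01B => //; apply: C1on01Z; exact: C1on01_id.
have cg : cont01 g.
  by apply: cont01B => //; apply: cont01B; [case: Cb|exact: cont01_cst].
have int_h : (\int[mu]_(t in `[0%R, 1%R]) (db t - K * 1)%:E =
    (b 1 - b 0 - K)%:E)%E.
  rewrite (@continuous_FTC2 _ _ (fun t => b t - K * t))//.
  - by rewrite -EFinB; congr _%:E; ring.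
  - split; first by move=> x /B' [].
    + by have /continuous_within_itvP P := @ltr01 R; move: cB => /P[].
    + by have /continuous_within_itvP P := @ltr01 R; move: cB => /P[].
  - by move=> x /B' H; rewrite derive1E; exact: derive_val.
have int_f : (\int[mu]_(t in `[0%R, 1%R]) (f t)%:E =
    \int[mu]_(t in `[0%R, 1%R]) (g t)%:E + (b 1 - b 0 - K)%:E)%E.
  rewrite -int_h -integralD//=; [|exact: cont01_integrable..].
  by apply: eq_integral => t _; rewrite -EFinD /g mulr1 subrK.
have g0 t : t \in `[0, 1] -> 0 <= g t by move=> /hf; rewrite subr_ge0.
have ig0 : (0 <= \int[mu]_(t in `[0%R, 1%R]) (g t)%:E)%E.
  by apply: integral_ge0 => t /= t01; rewrite lee_fin g0.
rewrite int_f; split; first by rewrite leeDr.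
rewrite -leeBrDr// subee// => ig_le0 t t01; apply/eqP; rewrite -subr_eq0.
apply/negP => /negP gt0.
have := integral01_gt0 cg g0 t01; rewrite lt_neqAle eq_sym gt0 g0.
  by move=> /(_ isT); rewrite ltNge ig_le0.
exact: subset_itv_oo_cc.
Qed.

End CalibrationIntegral.

(** * The calibration *)

Section Calibration.
Variable R : realType.
Implicit Type t : R.

Definition C1mx m n (P dP : R -> 'M[R]_(m, n)) : Prop :=
  forall i j, C1on01 (fun t => P t i j) (fun t => dP t i j).

Lemma C1on01_ext (f df g dg : R -> R) : (forall t, f t = g t) ->
  (forall t, df t = dg t) -> C1on01 f df -> C1on01 g dg.
Proof. by move=> /funext -> /funext ->. Qed.

(** This certifies [dschur_u] as the derivative of [schur_u] along a curve. The identity with the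
    product rule holds with the inverse of the pivot treated as an indeterminate, hence for every
    real [t]. *)
Lemma C1mx_schur_u n (P dP : R -> 'M[R]_(1 + n)) :
  (forall t, t \in `[0, 1] -> P t 0 0 != 0) -> C1mx P dP ->
  C1mx (fun t => schur_u (P t)) (fun t => dschur_u (P t) (dP t)).
Proof.
move=> p0 CP i j; apply: C1on01_ext (C1on01M (C1on01V p0 (CP 0 0))
  (CP (rshift 1 i) (lshift n j))) => t; rewrite !mxE// -exprVn; ring.
Qed.

Lemma C1mx_schur_S n (P dP : R -> 'M[R]_(1 + n)) :
  (forall t, t \in `[0, 1] -> P t 0 0 != 0) -> C1mx P dP ->
  C1mx (fun t => schur_S (P t)) (fun t => dschur_S (P t) (dP t)).
Proof.
move=> p0 CP i j; have Cu := C1mx_schur_u p0 CP.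
apply: C1on01_ext (C1on01B (CP (rshift 1 i) (rshift 1 j))
  (C1on01M (CP 0 0) (C1on01M (Cu i 0) (Cu j 0)))) => t.
  by rewrite !mxE big_ord1 !mxE.
rewrite /schur_S /dschur_S.
move: (schur_u _) (dschur_u _ _) => u x.
by rewrite !mxE !big_ord1 !mxE; ring.
Qed.

Lemma dschur_S_sym n (P D : 'M[R]_(1 + n)) :
  D^T = D -> (dschur_S P D)^T = dschur_S P D.
Proof.
move=> symD; rewrite /dschur_S.
move: (schur_u _) (dschur_u _ _) => u x.
apply/matrixP => i j; rewrite !mxE !big_ord1 !mxE -{1}symD mxE; ring.
Qed.

(** Diagonal endpoints have diagonal Schur complements, so the endpoint conditions pass to the
    smaller size in the induction. *)
Lemma schur_diag n (d : 'rV[R]_(1 + n)) :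
  schur_u (diag_mx d) = 0 /\ schur_S (diag_mx d) = diag_mx (rsubmx d).
Proof.
have u0 : schur_u (diag_mx d) = 0.
  by apply/matrixP => i j; rewrite !mxE ord1/= mulr0.
split=> //; rewrite /schur_S u0 mul0mx scaler0 subr0.
by apply/matrixP => i j; rewrite !mxE (inj_eq (@rshift_inj _ _)).
Qed.

(* b is 2 sum_i c_i ln d_i, where the d_i are the pivots of P. *)
Lemma diagonal_calibration n (c : 'rV[R]_n) (P dP : R -> 'M[R]_n) :
  (forall t, t \in `[0, 1] -> posdefmx (P t)) ->
  (forall t, t \in `[0, 1] -> (dP t)^T = dP t) ->
  C1mx P dP -> P 0 = 1%:M -> P 1 = diag_mx (map_mx expR c) ->
  let K := \sum_i c 0 i ^+ 2 in
  exists b db, [/\ C1on01 b db, b 1 - b 0 = 2 * K,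
    forall t, t \in `[0, 1] -> db t - K <= energy (P t) (dP t) &
    (forall t, t \in `]0, 1[ -> energy (P t) (dP t) = db t - K) ->
    forall t, t \in `[0, 1] -> P t = diag_mx (\row_i expR (t * c 0 i))].
Proof.
elim: n c P dP => [|n IHn] c P dP pP symdP CP P0 P1 K.
  exists (fun=> 0), (fun=> 0); split; first exact: C1on01_cst.
  - by rewrite /K big_ord0; ring.
  - by move=> t _; rewrite /K big_ord0 /energy /mxtrace big_ord0 subrr.
  - by move=> _ t _; apply/matrixP => -[].
(* The sizes [n.+1] and [1 + n] are convertible; the retyped copies expose the block structure. *)
pose PP : R -> 'M[R]_(1 + n) := P; pose dPP : R -> 'M[R]_(1 + n) := dP.
pose S t := schur_S (PP t); pose dS t := dschur_S (PP t) (dPP t).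
pose c' : 'rV[R]_n := rsubmx (c : 'rV_(1 + n)).
have p_gt0 t : t \in `[0, 1] -> 0 < PP t 0 0.
  by move=> /pP; exact: posdefmx_diag_gt0.
have p0 t : t \in `[0, 1] -> PP t 0 0 != 0 by move=> /p_gt0 /lt0r_neq0.
have pS t : t \in `[0, 1] -> posdefmx (S t) by move=> /pP /schur_S_posdef.
have CS : C1mx S dS by apply: C1mx_schur_S => // t /p0.
have Cu : C1mx (fun t => schur_u (PP t)) (fun t => dschur_u (PP t) (dPP t)).
  by apply: C1mx_schur_u => // t /p0.
have PP0 : PP 0 = diag_mx (const_mx 1 : 'rV_(1 + n)) by rewrite diag_const_mx.
have PP1 : PP 1 = diag_mx (map_mx expR c : 'rV_(1 + n)) by [].
have [u0 S0] := schur_diag (const_mx 1 : 'rV_(1 + n)).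
have [_ S1] := schur_diag (map_mx expR c : 'rV_(1 + n)).
have [|||b [db [Cb bE bK beq]]] := IHn c' S dS pS _ CS.
- by move=> t /symdP; exact: dschur_S_sym.
- rewrite /S PP0 S0 -diag_const_mx; congr diag_mx.
  by apply/rowP => i; rewrite !mxE.
- by rewrite /S PP1 S1; congr diag_mx; apply/rowP => i; rewrite !mxE.
set K' := \sum_i _ in bE bK beq.
have KE : K = c 0 0 ^+ 2 + K'.
  rewrite /K big_ord_recl; congr (_ + _); apply: eq_bigr => i _.
  by rewrite mxE; congr (c 0 _ ^+ 2); apply: val_inj.
pose l t := ln (PP t 0 0); pose dl t := dPP t 0 0 / PP t 0 0.
have Cl : C1on01 l dl by apply: C1on01_ln => // t /p_gt0.
pose v t := 2 * PP t 0 0 * \tr (invmx (S t) *m dschur_u (PP t) (dPP t) *m 1%:M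
                 *m (dschur_u (PP t) (dPP t))^T).
have eE t : t \in `[0, 1] ->
    energy (P t) (dP t) = dl t ^+ 2 + v t + energy (S t) (dS t).
  by move=> t01; exact: (energy_schur (pP t t01) (symdP t t01)).
have v0 t : t \in `[0, 1] -> 0 <= v t.
  move=> t01; apply: mulr_ge0; first by rewrite mulr_ge0// ltW// p_gt0.
  by apply: mxtrace_posdef_ge0; [exact/posdefmx_inv/pS|exact: posdefmx1].
exists (fun t => 2 * c 0 0 * l t + b t), (fun t => 2 * c 0 0 * dl t + db t).
split.
- exact: C1on01D (C1on01Z _ Cl) Cb.
- have l0 : l 0 = 0 by rewrite /l PP0 !mxE ln1.
  have l1 : l 1 = c 0 0 by rewrite /l PP1 !mxE expRK.
  by rewrite opprD addrACA bE l0 l1 KE; ring.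
(* Three inequalities add up: [dl ^+ 2 >= 2 c_0 dl - c_0 ^+ 2] by completing the square, [v >= 0],
   and the bound for the Schur complement. *)
- move=> t t01; rewrite eE// KE; have := bK t t01; have := v0 t t01.
  have := sqr_ge0 (dl t - c 0 0); nra.
move=> energyE.
(* The three nonnegative defects sum to zero, so each of them vanishes. *)
have eq0 t : t \in `]0, 1[ -> [/\ dl t = c 0 0, dschur_u (PP t) (dPP t) = 0 &
    energy (S t) (dS t) = db t - K'].
  move=> t01; have t01' := subset_itv_oo_cc t01.
  have := energyE t t01; rewrite eE// KE => E.
  have h1 := sqr_ge0 (dl t - c 0 0); have h2 := v0 t t01'; have h3 := bK t t01'.
  have dlE : dl t - c 0 0 = 0.
    by apply/eqP; rewrite -sqrf_eq0; apply/eqP/le_anti; rewrite h1 andbT; nra.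
  have vE : v t = 0 by apply/le_anti; rewrite h2 andbT; nra.
  have e3 : energy (S t) (dS t) = db t - K' by nra.
  split=> //; first exact: subr0_eq.
  apply: (mxtrace_posdef_eq0 (posdefmx_inv (pS _ t01')) (posdefmx1 _ 1)).
  move: vE => /eqP; rewrite /v !mulf_eq0 pnatr_eq0 /= (negbTE (p0 _ t01')).
  by move=> /eqP.
have SE := beq (fun t t01 => let: And3 _ _ H := eq0 t t01 in H).
have uE t : t \in `[0, 1] -> schur_u (PP t) = 0.
  move=> t01; apply/matrixP => i j; rewrite (C1on01_eq0 (Cu i j) _ t01).
    by rewrite PP0 u0.
  by move=> s s01; have [_ -> _] := eq0 s s01; rewrite mxE.
(* The function [l t - c 0 0 * t] has zero derivative and vanishes at 0. *)
have pE t : t \in `[0, 1] -> PP t 0 0 = expR (t * c 0 0).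
  move=> t01.
  have Cd : C1on01 (fun t => l t - c 0 0 * t) (fun t => dl t - c 0 0 * 1).
    by apply: C1on01B => //; apply: C1on01Z; exact: C1on01_id.
  have := C1on01_eq0 Cd _ t01; rewrite {2}/l PP0 !mxE ln1 mulr0 subr0 => lE.
  rewrite mulrC -[PP t 0 0]lnK ?posrE ?p_gt0//; congr expR.
  apply: subr0_eq; apply: lE => s s01.
  by have [-> _ _] := eq0 s s01; rewrite mulr1 subrr.
move=> t t01.
(* With [u = 0] the triangular factor is the identity. *)
have PE : PP t = block_mx (PP t 0 0)%:M 0 0 (S t).
  rewrite {1}(schur_decomp (pP t t01 : posdefmx (PP t))) uE//.
  by rewrite /schur_L -scalar_mx_block trmx1 mul1mx mulmx1.
have dE : \row_i expR (t * c 0 i) =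
    row_mx (PP t 0 0)%:M (\row_i expR (t * c' 0 i)) :> 'rV[R]_(1 + n).
  apply/rowP => i; rewrite !mxE; case: splitP => j ij; rewrite !mxE.
    by rewrite ord1 eqxx pE// (_ : i = 0)//; apply: val_inj; rewrite /= ij ord1.
  by congr (expR (t * c 0 _)); apply: val_inj.
rewrite -/(PP t) PE (SE _ t01).
have -> : (PP t 0 0)%:M = diag_mx (PP t 0 0)%:M :> 'M[R]_1.
  by apply/matrixP => i j; rewrite !ord1 !mxE eqxx.
by rewrite dE; exact/esym/(@diag_mx_row _ n 1).
Qed.

End Calibration.

(** * The geodesic *)

Section GeodesicCoordinates.
Variables (R : realType) (n : nat).
Implicit Types (W P : 'M[R]_n) (c : 'rV[R]_n) (t : R).

Definition geodesic W c t : 'M[R]_n :=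
  W *m diag_mx (\row_i expR (t * c 0 i)) *m W^T.

Definition dgeodesic W c t : 'M[R]_n :=
  W *m diag_mx (\row_i (c 0 i * expR (t * c 0 i))) *m W^T.

Definition geodesic_gen W c : 'M[R]_n :=
  2^-1 *: (W *m diag_mx c *m invmx W).

(** Diagonalizing [S^-1 P1 S^-1 = U diag(d) U^T] and setting [W = S U], [c = ln d] turns matrix
    powers and logarithms into scalar exponentials and logarithms of the eigenvalues. *)
Lemma info_geodesic (P0 P1 : 'M[R]_n) : posdefmx P0 -> posdefmx P1 ->
  exists W c, [/\ W \in unitmx, P0 = W *m W^T,
    P1 = W *m diag_mx (map_mx expR c) *m W^T,
    forall t, P_info P0 P1 t = geodesic W c t &
    A_info P0 P1 = geodesic_gen W c].
Proof.
move=> /sqrtmxP; rewrite /P_info /A_info; set S := sqrtmx P0 => -[pS SS] pP1.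
have uS := posdefmx_unit pS; have symS := pS.1.
have pM : posdefmx (invmx S *m P1 *m invmx S).
  have := posdefmx_congr (_ : invmx S \in unitmx) pP1.
  by rewrite trmx_inv symS unitmx_inv; apply.
have [U [d [oU ME]]] := real_symmetric_spectral pM.1.
have U'U := orthogonalmxC oU.
have [uU uU'] := mulmx1_unit oU.
have /posdefmx_diag d0 : posdefmx (diag_mx d).
  have := posdefmx_congr uU' pM.
  by rewrite ME trmxK !mulmxA U'U mul1mx -mulmxA U'U mulmx1.
have WT : (S *m U)^T = U^T *m S by rewrite trmx_mul symS.
have dE : d = map_mx expR (map_mx (@ln R) d).
  by apply/rowP => i; rewrite !mxE lnK ?posrE.
exists (S *m U), (map_mx (@ln R) d); split.
- by rewrite unitmx_mul uS.
- by rewrite WT mulmxA -(mulmxA S) oU mulmx1 SS.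
- rewrite WT -dE mulmxA -!(mulmxA S) -ME !mulmxA mulmxV// mul1mx.
  by rewrite mulmxKV.
- move=> t; rewrite /geodesic WT /powmx ME mxfunE// !mulmxA.
  congr (_ *m diag_mx _ *m _ *m _); apply/rowP => i.
  by rewrite !mxE /powR gt_eqF.
- rewrite /geodesic_gen /logmx ME mxfunE// !mulmxA.
  have -> : invmx (S *m U) = U^T *m invmx S.
    apply: (can_inj (mulKmx (_ : S *m U \in unitmx))).
      by rewrite unitmx_mul uS.
    rewrite mulmxV ?unitmx_mul ?uS// !mulmxA -(mulmxA S) oU mulmx1.
    by rewrite mulmxV.
  by rewrite !mulmxA.
Qed.

Variables (W : 'M[R]_n) (c : 'rV[R]_n).
Hypothesis uW : W \in unitmx.

Lemma geodesic_posdef t : posdefmx (geodesic W c t).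
Proof.
apply: posdefmx_congr => //.
by apply/posdefmx_diag => i; rewrite mxE expR_gt0.
Qed.

(** The product is half of the velocity, hence symmetric: the generator is thus the cheapest one for
    its curve. *)
Lemma geodesic_genM t :
  geodesic_gen W c *m geodesic W c t = 2^-1 *: dgeodesic W c t.
Proof.
rewrite -scalemxAl /geodesic !mulmxA mulmxKV// -(mulmxA W) mulmx_diag.
by congr (_ *: (_ *m diag_mx _ *m _)); apply/rowP => i; rewrite !mxE.
Qed.

Lemma dgeodesic_sym t : (dgeodesic W c t)^T = dgeodesic W c t.
Proof. by rewrite !trmx_mul trmxK tr_diag_mx mulmxA. Qed.

Lemma geodesicM_gen t :
  geodesic W c t *m (geodesic_gen W c)^T = 2^-1 *: dgeodesic W c t.
Proof.
rewrite -(geodesic_posdef t).1 -trmx_mul geodesic_genM trmx_scale.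
by rewrite dgeodesic_sym.
Qed.

Lemma dgeodesicE t : dgeodesic W c t =
  geodesic_gen W c *m geodesic W c t + geodesic W c t *m (geodesic_gen W c)^T.
Proof.
have half2 : 2^-1 + 2^-1 = 1 :> R by field.
by rewrite geodesic_genM geodesicM_gen -scalerDl half2 scale1r.
Qed.

(** The geodesic has constant speed: the symmetry of [A P] removes the second term of [f_infoE], and
    in the frame [W] the energy is the sum of the squared logarithmic derivatives of the diagonal
    entries. *)
Lemma f_info_geodesic t :
  f_info (geodesic W c t) (geodesic_gen W c) = \sum_i c 0 i ^+ 2.
Proof.
rewrite f_infoE; last exact: geodesic_posdef.
rewrite -dgeodesicE geodesic_genM geodesicM_gen subrr mulmx0 !mul0mx.
rewrite mxtrace0 addr0.
pose e := \row_i expR (t * c 0 i).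
have VE : invmx (diag_mx e) = diag_mx (map_mx GRing.inv e).
  have EV : diag_mx e *m diag_mx (map_mx GRing.inv e) = 1%:M.
    rewrite mulmx_diag -diag_const_mx; congr diag_mx; apply/rowP => i.
    by rewrite !mxE divff// gt_eqF ?expR_gt0.
  have [ue _] := mulmx1_unit EV.
  by apply: (can_inj (mulKmx ue)); rewrite mulmxV.
rewrite energy_congr//; last first.
  by apply/posdefmx_unit/posdefmx_diag => i; rewrite mxE expR_gt0.
rewrite /energy VE !mulmx_diag mxtrace_diag; apply: eq_bigr => i _.
by rewrite !mxE; field; rewrite gt_eqF ?expR_gt0.
Qed.

Lemma geodesic_entry t i j :
  geodesic W c t i j = \sum_k (W i k * W j k) * expR (t * c 0 k).
Proof.
rewrite /geodesic mul_mx_diag mxE; apply: eq_bigr => k _.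
by rewrite !mxE; ring.
Qed.

Lemma dgeodesic_entry t i j :
  dgeodesic W c t i j = \sum_k (W i k * W j k) * (c 0 k * expR (t * c 0 k)).
Proof.
rewrite /dgeodesic mul_mx_diag mxE; apply: eq_bigr => k _.
by rewrite !mxE; ring.
Qed.

Lemma is_derive_geodesic t i j :
  is_derive t 1 (fun s => geodesic W c s i j) (dgeodesic W c t i j).
Proof.
pose F k := (fun s : R => (W i k * W j k) * expR (s * c 0 k)).
rewrite dgeodesic_entry (_ : (fun s => _) = \sum_(k < n) F k); last first.
  by apply/funext => s; rewrite fct_sumE geodesic_entry.
apply: is_derive_sum => k.
have dl : is_derive t 1 (fun s : R => s * c 0 k) (c 0 k).
  have := is_deriveM (is_derive_id t 1) (is_derive_cst (c 0 k) t 1).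
  by rewrite scaler0 add0r [_ *: _]mulr1.
rewrite [c 0 k * _]mulrC.
exact: is_deriveZ (is_derive1_comp (is_derive_expR _) dl).
Qed.

Lemma cont01_dgeodesic i j : cont01 (fun t => dgeodesic W c t i j).
Proof.
under eq_fun do rewrite dgeodesic_entry.
apply: cont01_sum => k; apply: cont01M; first exact: cont01_cst.
apply: cont01M; first exact: cont01_cst.
apply: (@cont01_comp _ (fun t => t * c 0 k)) => [|t _].
  by apply: cont01M; [exact: cont01_id|exact: cont01_cst].
exact: continuous_expR.
Qed.

Lemma C1mx_geodesic : C1mx (geodesic W c) (dgeodesic W c).
Proof.
move=> i j; split; last by move=> t _; exact: is_derive_geodesic.
  apply: continuous_subspaceT => t.
  apply/differentiable_continuous/derivable1_diffP.
  by case: (is_derive_geodesic t i j).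
exact: cont01_dgeodesic.
Qed.

End GeodesicCoordinates.

(** * Feasible curves *)

Section Curves.
Variable R : realType.
Implicit Type t : R.

(** The substitution [s = h + t] links difference quotients centred at [t], as in
    [has_derivative01], with those written in the increment [h]. *)
Lemma is_derive1P (f : R -> R) t l :
  is_derive t 1 f l <-> (s - t)^-1 * (f s - f t) @[s --> t^'] --> l.
Proof.
split.
- move=> [df <-]; apply/cvgrPdist_lt => e e0.
  move: df => /cvgrPdist_lt/(_ _ e0)[d /= d0 hd].
  exists d => //= s; rewrite /ball_/= distrC => sd st.
  have := hd (s - t); rewrite /ball_/= sub0r normrN => /(_ sd).
  by rewrite subr_eq0 => /(_ st); rewrite [_ *: 1]mulr1 subrK.
- move=> fl.
  have dfl : h^-1 *: (f (h *: 1 + t) - f t) @[h --> 0^'] --> l.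
    apply/cvgrPdist_lt => e e0; move: fl => /cvgrPdist_lt/(_ _ e0)[d /= d0 hd].
    exists d => //= h; rewrite /ball_/= sub0r normrN => hlt h0.
    have := hd (h + t); rewrite /ball_/= opprD addrC subrK normrN => /(_ hlt).
    rewrite addrK [h *: 1]mulr1; apply.
    by rewrite -subr_eq0 addrK.
  by apply: DeriveDef; [apply/cvg_ex; exists l|exact/cvg_lim].
Qed.

(** The matrix norm is a maximum over finitely many entries, so finitely many eventual bounds can be
    combined; conversely, coordinates are continuous. *)
Lemma cvg_mx m n (T : Type) (F : set_system T) (FF : Filter F)
    (M : T -> 'M[R]_(m, n)) (L : 'M[R]_(m, n)) :
  (forall i j, M s i j @[s --> F] --> L i j) <-> M s @[s --> F] --> L.
Proof.
split=> [ML|ML i j]; last exact: cvg_comp ML (@coord_continuous _ _ _ i j L).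
apply/cvgrPdist_le => /= e e0.
near=> x.
rewrite /Num.Def.normr/= mx_normrE (bigmax_le _ (ltW e0))//= => -[i j] _.
rewrite !mxE/=.
move: i j; near: x; apply: filter_forall => /= i; apply: filter_forall => /= j.
exact: ((cvgrPdist_le _ _).1 (ML i j) _ e0).
Unshelve. all: by end_near. Qed.

Lemma cvg_dnbhs_within (f : R -> R) t (l : R) : t \in `]0, 1[ ->
  f s @[s --> within `[0, 1] t^'] --> l -> f s @[s --> t^'] --> l.
Proof.
move=> t01 fl; apply/cvgrPdist_lt => e e0.
move: fl => /cvgrPdist_lt/(_ _ e0); rewrite near_withinE => fl.
near=> s; suff : s \in `[0, 1] -> `|l - f s| < e.
  apply; apply: subset_itv_oo_cc; near: s; apply: nbhs_dnbhs.
  exact: near_in_itvoo.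
by near: s.
Unshelve. all: by end_near. Qed.

(** Multiplying the convergent quotient by [s - t], which tends to 0, gives [f s - f t --> 0],
    one-sidedly at the endpoints. *)
Lemma cont01_quotient (f df : R -> R) :
  (forall t, t \in `[0, 1] ->
    (s - t)^-1 * (f s - f t) @[s --> within `[0, 1] t^'] --> df t) -> cont01 f.
Proof.
move=> fdf; apply/subspace_continuousP => t t01.
have : (s - t) * ((s - t)^-1 * (f s - f t)) @[s --> within `[0, 1] t^'] -->
    (t - t) * df t.
  apply: cvgM (fdf t t01); apply: cvgB; last exact: cvg_cst.
  apply: cvg_within_filter; exact: nbhs_dnbhs.
rewrite subrr mul0r => /cvgrPdist_lt f0; apply/cvgrPdist_lt => e e0.
have := f0 e e0; rewrite !near_withinE; apply: filterS => s hs s01 /=.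
have [->|st] := eqVneq s t; first by rewrite subrr normr0.
by have := hs st s01; rewrite mulVKf ?subr_eq0// sub0r opprB.
Qed.

Lemma has_derivative01_C1mx n (P dP : R -> 'M[R]_n) :
  has_derivative01 P dP -> {within `[0, 1], continuous dP} -> C1mx P dP.
Proof.
move=> PdP cdP i j.
have q t : t \in `[0, 1] -> (s - t)^-1 * (P s i j - P t i j)
     @[s --> within `[0, 1] t^'] --> dP t i j.
  move=> /PdP /cvg_mx/(_ i j).
  rewrite (_ : (fun s => _) = (fun s => (s - t)^-1 * (P s i j - P t i j)))//.
  by apply/funext => s; rewrite !mxE.
split; first exact: cont01_quotient q.
  by move=> t; exact: ((cvg_mx _ _ _).2 (cdP t)).
by move=> t t01; apply/is_derive1P/cvg_dnbhs_within/q/subset_itv_oo_cc.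
Qed.


Lemma C1on01_derive_eq (f df g dg : R -> R) : C1on01 f df -> C1on01 g dg ->
  (forall t, t \in `[0, 1] -> f t = g t) ->
  forall t, t \in `]0, 1[ -> df t = dg t.
Proof.
move=> [_ _ ff] [_ _ gg] fg t t01.
have fg' : \near t, f t = g t.
  near=> s; apply/fg/subset_itv_oo_cc; near: s; exact: near_in_itvoo.
have [_ <-] := ff t t01; have [_ <-] := gg t t01.
exact: near_eq_derive.
Unshelve. all: by end_near. Qed.

Lemma C1mx_congr m n p (T : 'M[R]_(m, n)) (V : 'M[R]_(n, p))
    (P dP : R -> 'M[R]_n) :
  C1mx P dP -> C1mx (fun t => T *m P t *m V) (fun t => T *m dP t *m V).
Proof.
move=> CP i j.
have mE (M : 'M[R]_n) : (T *m M *m V) i j =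
    \sum_k V k j * \sum_l T i l * M l k.
  by rewrite mxE; apply: eq_bigr => k _; rewrite mxE mulrC.
apply: (C1on01_ext (fun t => esym (mE (P t))) (fun t => esym (mE (dP t)))).
apply: C1on01_sum => k; apply: C1on01Z.
by apply: C1on01_sum => l; apply: C1on01Z.
Qed.

Definition contmx m n (P : R -> 'M[R]_(m, n)) : Prop :=
  forall i j, cont01 (fun t => P t i j).

Lemma contmx_mul m n p (P : R -> 'M[R]_(m, n)) (Q : R -> 'M[R]_(n, p)) :
  contmx P -> contmx Q -> contmx (fun t => P t *m Q t).
Proof.
move=> cP cQ i j; under eq_fun do rewrite mxE.
by apply: cont01_sum => k; exact: cont01M.
Qed.

Lemma contmx_tr m n (P : R -> 'M[R]_(m, n)) :
  contmx P -> contmx (fun t => (P t)^T).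
Proof. by move=> cP i j; under eq_fun do rewrite mxE; exact: cP. Qed.

Lemma cont01_mxtrace n (P : R -> 'M[R]_n) :
  contmx P -> cont01 (fun t => \tr (P t)).
Proof. by move=> cP; apply: cont01_sum => k; exact: cP. Qed.

Lemma cont01_det n (P : R -> 'M[R]_n) :
  contmx P -> cont01 (fun t => \det (P t)).
Proof.
move=> cP; apply: cont01_sum => s; apply: cont01M; first exact: cont01_cst.
by apply: cont01_prod => i; exact: cP.
Qed.

Lemma contmx_inv n (P : R -> 'M[R]_n) :
  (forall t, t \in `[0, 1] -> P t \in unitmx) ->
  contmx P -> contmx (fun t => invmx (P t)).
Proof.
move=> uP cP i j.
apply: (@cont01_eq _ (fun t => (\det (P t))^-1 * cofactor (P t) j i)).
  by move=> t t01; rewrite /invmx uP// !mxE.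
apply: cont01M.
  by apply: cont01V; [exact: cont01_det|move=> t /uP; rewrite unitmxE unitfE].
apply: cont01M; first exact: cont01_cst.
apply: cont01_det => k l.
by under eq_fun do rewrite !mxE; exact: cP.
Qed.

Lemma within_continuous_contmx m n (P : R -> 'M[R]_(m, n)) :
  {within `[0, 1], continuous P} <-> contmx P.
Proof.
split=> [cP i j t|cP t]; first exact: ((cvg_mx _ _ _).2 (cP t)).
by apply/cvg_mx => i j; exact: cP.
Qed.

Lemma cont01_f_info n (P A : R -> 'M[R]_n) :
  (forall t, t \in `[0, 1] -> posdefmx (P t)) -> contmx P -> contmx A ->
  cont01 (fun t => f_info (P t) (A t)).
Proof.
move=> pP cP cA; apply: cont01M; first exact: cont01_cst.
apply/cont01_mxtrace/(contmx_mul _ (contmx_tr cA)).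
apply/(contmx_mul _ cP)/(contmx_mul _ cA)/contmx_inv => // t /pP.
exact: posdefmx_unit.
Qed.

Lemma geodesic_feasible n (W : 'M[R]_n) (c : 'rV[R]_n) : W \in unitmx ->
  feasible (W *m W^T) (W *m diag_mx (map_mx expR c) *m W^T)
    (geodesic W c) (fun=> geodesic_gen W c).
Proof.
move=> uW; split.
- by move=> t _; exact: geodesic_posdef.
- by apply/within_continuous_contmx => i j; exact: cont01_cst.
- exists (dgeodesic W c); split.
  + move=> t t01; apply/cvg_mx => i j; apply: cvg_within_filter.
    rewrite (_ : (fun s => _) = (fun s =>
      (s - t)^-1 * (geodesic W c s i j - geodesic W c t i j))).
      by apply/is_derive1P; exact: is_derive_geodesic.
    by apply/funext => s; rewrite !mxE.
  + by apply/within_continuous_contmx => i j; exact: cont01_dgeodesic.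
  + by move=> t _; exact: dgeodesicE.
- split; rewrite /geodesic.
    rewrite (_ : \row_i _ = const_mx 1) ?diag_const_mx ?mulmx1//.
    by apply/rowP => i; rewrite !mxE mul0r expR0.
  by congr (_ *m diag_mx _ *m _); apply/rowP => i; rewrite !mxE mul1r.
Qed.

Lemma geodesic_action n (W : 'M[R]_n) (c : 'rV[R]_n) : W \in unitmx ->
  info_action (geodesic W c) (fun=> geodesic_gen W c) =
  (\sum_i c 0 i ^+ 2)%:E.
Proof.
move=> uW; rewrite /info_action.
under eq_integral do rewrite f_info_geodesic//.
rewrite integral_cst//= lebesgue_measure_itv/= lte_fin ltr01.
by rewrite oppr0 adde0 mule1.
Qed.

(** Congruence by [W^-1] brings the endpoints to the identity and a diagonal matrix, where
    [diagonal_calibration] bounds the energy. Adding the nonnegative term of [f_infoE] and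
    integrating gives the bound; equality makes both inequalities sharp. *)
Lemma feasible_action n (W : 'M[R]_n) (c : 'rV[R]_n) (P A : R -> 'M[R]_n) :
  W \in unitmx ->
  feasible (W *m W^T) (W *m diag_mx (map_mx expR c) *m W^T) P A ->
  let k := \sum_i c 0 i ^+ 2 in
  (k%:E <= info_action P A)%E /\
  ((info_action P A <= k%:E)%E -> forall t, t \in `[0, 1] ->
    P t = geodesic W c t /\ A t = geodesic_gen W c).
Proof.
move=> uW [pP /within_continuous_contmx cA [dP [hdP cdP dPE]] [P0 P1]] k.
have CP := has_derivative01_C1mx hdP cdP.
have uV : invmx W \in unitmx by rewrite unitmx_inv.
have WV' : W^T *m (invmx W)^T = 1%:M by rewrite -trmx_mul mulVmx// trmx1.
pose Q t := invmx W *m P t *m (invmx W)^T.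
pose dQ t := invmx W *m dP t *m (invmx W)^T.
have QK (M : 'M[R]_n) : W *m (invmx W *m M *m (invmx W)^T) *m W^T = M.
  by rewrite !mulmxA mulmxV// mul1mx -mulmxA -trmx_mul mulmxV// trmx1 mulmx1.
have KQ (M : 'M[R]_n) : invmx W *m (W *m M *m W^T) *m (invmx W)^T = M.
  by rewrite !mulmxA mulVmx// mul1mx -mulmxA WV' mulmx1.
have symdP t : t \in `[0, 1] -> (dP t)^T = dP t.
  by move=> t01; rewrite dPE// linearD/= !trmx_mul trmxK (pP t t01).1 addrC.
have [|||||b [db [Cb bE bK beq]]] := @diagonal_calibration _ _ c Q dQ.
- by move=> t /pP; exact: posdefmx_congr.
- by move=> t t01; rewrite /dQ !trmx_mul trmxK symdP// mulmxA.
- exact: C1mx_congr.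
- by have := KQ 1%:M; rewrite mulmx1 /Q P0.
- by rewrite /Q P1 KQ.
rewrite -/k in bE bK beq.
pose rem t := \tr (invmx (P t) *m (A t *m P t - P t *m (A t)^T) *m
  invmx (P t) *m (A t *m P t - P t *m (A t)^T)^T).
have fE t : t \in `[0, 1] -> f_info (P t) (A t) = energy (Q t) (dQ t) + rem t.
  move=> t01; rewrite f_infoE; last exact: pP.
  rewrite -dPE//.
  by rewrite energy_congr//; exact/posdefmx_unit/pP.
have rem0 t : t \in `[0, 1] -> 0 <= rem t.
  by move=> /pP/posdefmx_inv pV; exact: mxtrace_posdef_ge0.
have cf : cont01 (fun t => f_info (P t) (A t)).
  by apply: cont01_f_info => // i j; case: (CP i j).
have lb t : t \in `[0, 1] -> db t - k <= f_info (P t) (A t).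
  by move=> t01; rewrite fE// (le_trans (bK t t01))// lerDl rem0.
have [le_K eq_K] := integral01_calibration cf Cb lb.
(* The calibration grows by [2 * k] between the endpoints and its constant removes one [k]. *)
have bkE : b 1 - b 0 - k = k by rewrite bE; ring.
rewrite bkE in le_K eq_K; split=> // /eq_K fdb.
have split0 t : t \in `]0, 1[ -> energy (Q t) (dQ t) = db t - k /\ rem t = 0.
  move=> t01; have t01' := subset_itv_oo_cc t01.
  have := fdb t t01; rewrite fE//.
  by have := bK t t01'; have := rem0 t t01'; lra.
have PE t : t \in `[0, 1] -> P t = geodesic W c t.
  move=> t01; rewrite -[P t]QK -/(Q t) (beq _ t t01)// => s s01.
  by have [] := split0 s s01.
(* A vanishing remainder makes [A P] symmetric, so [A P] is half of [dP], the velocity of the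
   geodesic; cancelling the invertible [P] identifies [A]. Velocities are compared at interior
   times. *)
have AE t : t \in `]0, 1[ -> A t = geodesic_gen W c.
  move=> t01; have t01' := subset_itv_oo_cc t01.
  have uP := posdefmx_unit (pP t t01'); have [_ rem_t] := split0 t t01.
  have pV := posdefmx_inv (pP t t01').
  have AP : P t *m (A t)^T = A t *m P t.
    by apply/esym/subr0_eq; exact: (mxtrace_posdef_eq0 pV pV rem_t).
  have dPt : dP t = dgeodesic W c t.
    apply/matrixP => i j.
    have := C1on01_derive_eq (CP i j) (C1mx_geodesic W c i j); apply => //.
    by move=> s s01; rewrite PE.
  apply: (can_inj (mulmxK uP)); rewrite PE// geodesic_genM// -PE// -dPt dPE//.
  have half2 : 2^-1 + 2^-1 = 1 :> R by field.
  by rewrite AP scalerDr -scalerDl half2 scale1r.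
move=> t t01; split; first exact: PE.
apply/matrixP => i j.
(* Continuity of [A] carries the identity to the two endpoints. *)
by apply: (cont01_oo (cA i j) _ t01) => s /AE ->.
Qed.

End Curves.

Theorem proposition3 (R : realType) (n : nat) (P0 P1 : 'M[R]_n)
    (hP0 : posdefmx P0) (hP1 : posdefmx P1) :
  is_minimizer P0 P1 (P_info P0 P1) (fun=> A_info P0 P1) /\
  forall P A : R -> 'M[R]_n, is_minimizer P0 P1 P A ->
    forall t : R, t \in `[0, 1] ->
      P t = P_info P0 P1 t /\ A t = A_info P0 P1.
Proof.
have [W [c [uW P0E P1E /funext -> ->]]] := info_geodesic hP0 hP1.
rewrite {}P0E {}P1E; split.
  split; first exact: geodesic_feasible.
  by move=> Q B /(feasible_action uW)[+ _]; rewrite geodesic_action.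
(* Comparing a minimizer with the geodesic bounds its action by that of the geodesic, which triggers
   the equality case of [feasible_action]. *)
move=> P A [fPA /(_ _ _ (geodesic_feasible c uW))].
rewrite geodesic_action// => leK t t01.
by have [_ /(_ leK t t01)] := feasible_action uW fPA.
Qed.
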